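(* Let $K \subset \mathbb{R}^2$ be a convex body with centroid $\mathrm{c}(K) = \boldsymbol{0}$ and $\#(\mathrm{int}(K) \cap \mathbb{Z}^2) = 1$. Then $$\#(K \cap \mathbb{Z}^2) \leq 10.$$ Furthermore, equality holds if and only if $K$ is unimodularly equivalent to $$S_2 = 3\,\mathrm{conv}\{\boldsymbol{0}, \boldsymbol{e}_1, \boldsymbol{e}_2\} - (1,1) = \{\boldsymbol{x} \in \mathbb{R}^2 : x_1 \geq -1,\ x_2 \geq -1,\ x_1 + x_2 \leq 1\}.$$
   Context: A convex body in $\mathbb{R}^2$ is a compact convex set; here it has positive Lebesgue measure, so that its centroid is defined. The centroid of a Lebesgue measurable set $A \subset \mathbb{R}^2$ of positive Lebesgue measure $\mathrm{vol}(A)$ is $\mathrm{c}(A) = \frac{1}{\mathrm{vol}(A)} \int_A \boldsymbol{x} \, \mathrm{d}\boldsymbol{x}$. $\mathrm{int}(K)$ is the interior of $K$, $\boldsymbol{e}_1, \boldsymbol{e}_2$ are the unit vectors of $\mathbb{R}^2$, and $\mathrm{conv}$ denotes the convex hull. Two sets $A, B \subset \mathbb{R}^2$ are unimodularly equivalent if $A = UB + \boldsymbol{z}$ for some matrix $U \in \mathbb{Z}^{2 \times 2}$ with $|\det U| = 1$ and some $\boldsymbol{z} \in \mathbb{Z}^2$. *)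

(* Defs.v *)
From HB Require Import structures.
From mathcomp Require Import all_boot all_order all_algebra.
From mathcomp Require Import all_classical all_reals all_analysis.
From mathcomp Require Import ring lra.

Set Implicit Arguments.
Unset Strict Implicit.
Unset Printing Implicit Defensive.

Import Order.TTheory GRing.Theory Num.Theory.
Import numFieldNormedType.Exports.

Local Open Scope classical_set_scope.
Local Open Scope ring_scope.

(* The plane is [R * R]: this is the carrier of the product measure, and its
   product topology and its module structure are those of R^2. *)
Section plane.
Context {R : realType}.

(* [measurableTypeR R] is [R] with its Borel sigma-algebra. *)
Definition vol
    : {measure set (measurableTypeR R * measurableTypeR R) -> \bar R} :=
  (@lebesgue_measure R \x @lebesgue_measure R)%E.

Definition centroid (A : set (R * R)) : R * R :=
  (fine (vol A))^-1 *: (\int[vol]_(x in A) x.1, \int[vol]_(x in A) x.2).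

Definition convex_body (K : set (R * R)) : Prop :=
  [/\ compact K, convex_set K & (0 < vol K)%E].

Definition int_pt (z : int * int) : R * R := (z.1%:~R, z.2%:~R).

Definition Z2 : set (R * R) := range int_pt.

Definition int_mx_act (U : 'M[int]_2) (x : R * R) : R * R :=
  ((U 0 0)%:~R * x.1 + (U 0 1)%:~R * x.2,
   (U 1 0)%:~R * x.1 + (U 1 1)%:~R * x.2).

Definition unimodularly_equivalent (A B : set (R * R)) : Prop :=
  exists (U : 'M[int]_2) (z : int * int),
    `|\det U| = 1 /\ A = [set int_mx_act U x + int_pt z | x in B].

Definition convex_hull (A : set (R * R)) : set (R * R) :=
  smallest (@convex_set R (R * R)%type) A.

Definition S2 : set (R * R) :=
  [set 3 *: x - (1, 1) | x in convex_hull [set 0; (1, 0); (0, 1)]].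

Lemma S2E : S2 = [set x | [/\ -1 <= x.1, -1 <= x.2 & x.1 + x.2 <= 1]].
Proof.
have scE (t : R) (x : R * R) : t *: x = (t * x.1, t * x.2) by [].
apply/seteqP; split => [_ [x hx <-]|[x1 x2] /= [h1 h2 h12]].
  suff : [set x : R * R | [/\ 0 <= x.1, 0 <= x.2 & x.1 + x.2 <= 1]] x.
    by case: x {hx} => x1 x2 /= [? ? ?]; rewrite /GRing.scale /=; split; lra.
  apply: hx; split; last by move=> _ [[->|->]|->] /=; split; lra.
  move=> [a1 a2] [b1 b2] l; rewrite !inE /= => -[? ? ?] [? ? ?].
  have l0 : 0 <= l%:num by [].
  have l1 : l%:num <= 1 by [].
  by rewrite /conv /= /GRing.scale /= /unstable.onem; split; nra.
have -> : (x1, x2) = 3 *: ((x1 + 1) / 3, (x2 + 1) / 3) - (1, 1) :> R * R.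
  by rewrite !scE; congr (_, _) => /=; field.
apply: imageP => A [cA sA].
set a := (x1 + 1) / 3; set b := (x2 + 1) / 3.
have a0 : 0 <= a by rewrite /a; lra.
have b0 : 0 <= b by rewrite /b; lra.
have ab : a + b <= 1 by rewrite /a /b; lra.
move: a b a0 b0 ab => {x1 x2 h1 h2 h12} a b a0 b0 ab.
have cvx (p q : R * R) (t : R) : 0 <= t <= 1 -> A p -> A q ->
    A (t *: p + (1 - t) *: q).
  move=> t01 Ap Aq.
  have /andP[t0 t1] := t01.
  have := cA p q (@Itv01 R t t0 t1) (mem_set Ap) (mem_set Aq).
  by rewrite inE.
have A0 : A 0 by apply: sA; left; left.
have A1 : A (1, 0) by apply: sA; left; right.
have A2 : A (0, 1) by apply: sA; right.
have [s0|s0] := eqVneq (a + b) 0.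
  have [-> ->] : a = 0 /\ b = 0 by split; lra.
  exact: A0.
have s1 : 0 < a + b by rewrite lt_def s0; lra.
have Ac := cvx (1, 0) (0, 1) (a / (a + b)) _ A1 A2.
have -> : (a, b) = (a + b) *: (a / (a + b) *: ((1, 0) : R * R) +
    (1 - a / (a + b)) *: ((0, 1) : R * R)) + (1 - (a + b)) *: (0 : R * R).
  by rewrite !scE; congr (_, _) => /=; field.
apply: cvx => //; first by apply/andP; split; lra.
apply: Ac; rewrite ler_pdivrMr// ler_pdivlMr//; apply/andP; split; lra.
Qed.

End plane.

(* Main.v *)
Require Import Defs.
From mathcomp Require Import all_boot all_order all_algebra.
From mathcomp Require Import all_classical all_reals all_analysis.
From mathcomp Require Import measurable_realfun ring lra zify.
Import Order.TTheory GRing.Theory Num.Theory.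
Import numFieldNormedType.Exports.
Local Open Scope classical_set_scope.
Local Open Scope card_scope.
Local Open Scope ring_scope.

(** The centroid of a convex body is one of its interior points: otherwise
    some line through it would have the body on one side [separation], and the
    corresponding linear form would have a positive integral over the body,
    whereas the position of the centroid makes this integral zero
    [centroid_support].  So the origin is the only interior lattice point of K.

    The lattice points of K are compared modulo 3.  If no two of them are
    congruent, there are at most 9.  Otherwise let p and q be distinct and
    congruent.  The two points that cut the segment pq in three are distinct
    lattice points of K, so one of them is not interior, and K lies on one side
    of the line pq [supporting_line].  A lattice line parallel to pq and
    strictly between pq and 0 would cut the triangle 0pq along a segment that
    is long enough to contain a lattice point, and this point would be interior
    to K; so there is no such line [height1_edge].  In suitable unimodular
    coordinates K therefore lies in the half-plane y >= -1 and contains the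
    points (-1,-1), ..., (b,-1) for some b >= 2.

    The row y = 0 of K is contained in [-1, 1], since (1,0) and (-1,0) are not
    interior.  The segment from a point (c,-1) of the edge to a point (x,y) of K
    with y >= 0 crosses this row, which bounds |x + c y| by 1 + y [crossing].
    With an edge of length at least 6, these bounds confine the part of K above
    the row to heights at most 1/2, and its translate by a suitable vector
    (c,-1) to K.  The translation sends height y to y - 1 <= - y, so
    the mean height over K would be negative, whereas the centroid has
    height 0 [centroid_translate].  Hence the length of the edge is 3, 4 or 5,
    and the same bounds leave at most 10, 9 and 9 lattice points.  For length 3
    the tenth point is (-1,2), and if K contains it, then K contains S2.  Every
    edge of S2 has a lattice point in its relative interior, which prevents K
    from extending beyond that edge [hollow_S2]; so K is S2. *)

(** * Convex sets of the plane and their interior points *)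

Section geometry.
Context {R : realType}.
Set Implicit Arguments. Unset Strict Implicit. Unset Printing Implicit Defensive.
Implicit Types (K : set (R * R)) (p q r u v w x y z d : R * R).
Implicit Types (t a b c e : R).

Lemma addE x y : ((x + y).1 = x.1 + y.1) * ((x + y).2 = x.2 + y.2).
Proof. by []. Qed.
Lemma oppE x : ((- x).1 = - x.1) * ((- x).2 = - x.2).
Proof. by []. Qed.
Lemma scaleE t x : ((t *: x).1 = t * x.1) * ((t *: x).2 = t * x.2).
Proof. by []. Qed.
Lemma zeroE : ((0 : R * R).1 = 0) * ((0 : R * R).2 = 0).
Proof. by []. Qed.
Definition coordE := (addE, oppE, scaleE, zeroE).

Lemma coordP x y : x.1 = y.1 -> x.2 = y.2 -> x = y.
Proof. by case: x y => [x1 x2] [y1 y2] /= -> ->. Qed.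

Definition convex K := forall x y t, 0 <= t <= 1 -> K x -> K y ->
  K (t *: x + (1 - t) *: y).

Lemma convexP K : convex_set K -> convex K.
Proof.
move=> cK x y t t01 Kx Ky; have /andP[t0 t1] := t01.
have := cK x y (@Itv01 R t t0 t1) (mem_set Kx) (mem_set Ky).
by rewrite inE.
Qed.

(** The algebraic interior.  It is invariant under linear changes of
    coordinates by its very form, and for convex sets it is the topological
    interior ([core_interior] and [interior_core]). *)
Definition core K x := forall d, exists2 e, 0 < e & K (x + e *: d).

Lemma core_sub K x : core K x -> K x.
Proof. by move=> /(_ 0) [e _]; rewrite scaler0 addr0. Qed.

Lemma convex3 K p q u a b c : convex K -> K p -> K q -> K u ->
  0 <= a -> 0 <= b -> 0 <= c -> a + b + c = 1 -> K (a *: p + b *: q + c *: u).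
Proof.
move=> cK Kp Kq Ku a0 b0 c0 abc.
have [c1|c1] := eqVneq c 1.
  have -> : a = 0 by lra.
  have -> : b = 0 by lra.
  by rewrite c1 !scale0r scale1r !add0r.
have c'0 : 0 < 1 - c by rewrite subr_gt0 lt_neqAle c1; lra.
have K1 : K ((a / (1 - c)) *: p + (1 - a / (1 - c)) *: q).
  by apply: cK => //; rewrite divr_ge0 ?ler_pdivrMr//; lra.
have : K ((1 - c) *: ((a / (1 - c)) *: p + (1 - a / (1 - c)) *: q) +
   (1 - (1 - c)) *: u) by apply: cK => //; lra.
have -> : b = 1 - c - a by lra.
by congr K; apply: coordP; rewrite !coordE; field; lra.
Qed.

(** The homothety of ratio [t] and centre [w] maps [K] into itself and [z] to
    the point in question. *)
Lemma core_segment K z w t : convex K -> core K z -> K w -> 0 < t <= 1 ->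
  core K (t *: z + (1 - t) *: w).
Proof.
move=> cK cz Kw /andP[t0 t1] d; have [e e0 Ke] := cz d.
exists (t * e); first exact: mulr_gt0.
have t01 : 0 <= t <= 1 by lra.
have := cK _ _ t t01 Ke Kw.
by congr K; apply: coordP; rewrite !coordE; ring.
Qed.

Definition dot p q : R := p.1 * q.1 + p.2 * q.2.

Definition cross p q := p.1 * q.2 - p.2 * q.1.

(** Any direction [d] is a combination of the direction of the line through
    [p] and [q] and of the direction towards [u]; when [d] points to the side
    of [u], the second coefficient is nonnegative and a small step along [d]
    stays in the triangle with vertices [p], [q] and [u]. *)
Lemma half_core K p q u d t : convex K -> K p -> K q -> K u -> 0 < t < 1 ->
  cross (q - p) (u - p) != 0 ->
  0 <= cross (q - p) d / cross (q - p) (u - p) ->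
  exists2 e, 0 < e & K (t *: p + (1 - t) *: q + e *: d).
Proof.
move=> cK Kp Kq Ku /andP[t0 t1] D0.
set D := cross _ (u - p) in D0 *; set b := _ / D => b0.
(* Cramer's rule: [d] is [a] times [q - p] plus [b] times the vector from the
   point on the line to [u]. *)
pose a := cross d (u - (t *: p + (1 - t) *: q)) / D.
pose m := Num.min t (1 - t).
have m0 : 0 < m by rewrite lt_min; lra.
have mt : m <= t by rewrite ge_min lexx.
have mt' : m <= 1 - t by rewrite ge_min lexx orbT.
have N0 : 0 < 1 + `|a| + b by have := normr_ge0 a; lra.
exists (m / (1 + `|a| + b)); first exact: divr_gt0.
set e := m / _.
have e0 : 0 < e by exact: divr_gt0.
have em : e * (1 + `|a| + b) = m by rewrite /e; field; lra.
have ea : `|e * a| = e * `|a| by rewrite normrM gtr0_norm.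
have eb0 : 0 <= e * b by apply: mulr_ge0 => //; lra.
have ebm : e * b <= m by have := normr_ge0 (e * a); lra.
have := ler_norm (e * a); have := ler_norm (- (e * a)); rewrite normrN => ? ?.
have := @convex3 K p q u ((1 - e * b) * t - e * a)
  ((1 - e * b) * (1 - t) + e * a) (e * b) cK Kp Kq Ku.
have -> : ((1 - e * b) * t - e * a) *: p +
     ((1 - e * b) * (1 - t) + e * a) *: q + (e * b) *: u =
   t *: p + (1 - t) *: q + e *: d.
  rewrite /a /b; move: D0; rewrite /D /cross !coordE => D0.
  by apply: coordP; rewrite !coordE; field.
apply => //; last ring.
- have : e * b * t <= e * b by rewrite ler_piMr// ltW.
  by have := normr_ge0 (e * a); nra.
- have : e * b * (1 - t) <= e * b by rewrite ler_piMr//; lra.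
  by have := normr_ge0 (e * a); nra.
Qed.

(** A direction points to the side of [u] or to that of [v]. *)
Lemma core_between K p q u v t : convex K -> K p -> K q -> K u -> K v ->
  0 < t < 1 -> 0 < cross (q - p) (u - p) -> cross (q - p) (v - p) < 0 ->
  core K (t *: p + (1 - t) *: q).
Proof.
move=> cK Kp Kq Ku Kv t01 u0 v0 d.
have [d0|d0] := leP 0 (cross (q - p) d).
  by apply: (@half_core _ _ _ u) => //; [lra|rewrite divr_ge0// ltW].
by apply: (@half_core _ _ _ v) => //; [lra|rewrite -divrNN divr_ge0; lra].
Qed.

Lemma core_opposite K z a : convex K -> core K z -> 0 < a -> K (- a *: z) ->
  core K 0.
Proof.
move=> cK cz a0 Kw.
have a1 : 0 < 1 + a by lra.
have : core K (a / (1 + a) *: z + (1 - a / (1 + a)) *: (- a *: z)).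
  by apply: core_segment => //; rewrite divr_gt0// ler_pdivrMr//; lra.
by congr core; apply: coordP; rewrite !coordE; field; lra.
Qed.

(** In the coordinates [dot z] along [z] and [cross z] across it, the points
    of [K] on the axis have nonnegative first coordinate, for otherwise the
    origin would lie between such a point and [z].  By convexity, the ratios
    of the coordinates on the two sides of the axis are separated [ratio], and
    the infimum on one side gives the slope of a line that bounds [K]. *)
Lemma separation K z : convex K -> core K z -> ~ core K 0 ->
  exists2 c, (forall x, K x -> 0 <= dot c x) & 0 < dot c z.
Proof.
move=> cK cz c0.
have z0 : 0 < dot z z.
  have [] := (sqr_ge0 z.1, sqr_ge0 z.2).
  rewrite lt_neqAle /dot => ? ?; apply/andP; split; last by nra.
  apply/eqP => E; apply: c0; suff <- : z = 0 by [].
  by apply: coordP; rewrite coordE; nra.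
have axis y : K y -> cross z y = 0 -> 0 <= dot z y.
  move=> Ky y0; rewrite leNgt; apply/negP => yn; apply: c0.
  apply: (@core_opposite _ z (- dot z y / dot z z)) => //.
    by rewrite divr_gt0// oppr_gt0.
  suff E : dot z z *: y = dot z y *: z.
    suff -> : - (- dot z y / dot z z) *: z = y by [].
    by rewrite mulNr opprK mulrC -scalerA -E scalerA mulVf ?scale1r ?lt0r_neq0.
  move: y0; rewrite /cross => y0; apply: coordP; rewrite !coordE /dot.
    by have := congr1 (fun s => z.2 * s) y0; lra.
  by have := congr1 (fun s => z.1 * s) y0; lra.
have ratio x y : K x -> K y -> 0 < cross z x -> cross z y < 0 ->
    dot z y / cross z y <= dot z x / cross z x.
  move=> Kx Ky vx vy.
  rewrite ler_pdivlMr// mulrAC ler_ndivrMr//.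
  have D0 : 0 < cross z x - cross z y by lra.
  have := axis ((- cross z y / (cross z x - cross z y)) *: x +
     (1 - (- cross z y / (cross z x - cross z y))) *: y).
  have t01 : 0 <= - cross z y / (cross z x - cross z y) <= 1.
    by rewrite divr_ge0 ?ler_pdivrMr//; lra.
  move=> /(_ (cK _ _ _ t01 Kx Ky)).
  set t := - cross z y / _.
  have tE : t * (cross z x - cross z y) = - cross z y by rewrite /t; field; lra.
  have -> : cross z (t *: x + (1 - t) *: y) =
      t * (cross z x - cross z y) + cross z y by rewrite /cross !coordE; ring.
  have -> : dot z (t *: x + (1 - t) *: y) =
      t * (dot z x - dot z y) + dot z y by rewrite /dot !coordE; ring.
  rewrite tE addNr => /(_ erefl) h.
  have : 0 <= (t * (dot z x - dot z y) + dot z y) * (cross z x - cross z y).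
    by apply: mulr_ge0 => //; lra.
  by rewrite mulrDl mulrAC tE; lra.
have [e1 e10 K1] := cz (- z.2, z.1).
have [e2 e20 K2] := cz (z.2, - z.1).
set x1 := z + _ in K1; set x2 := z + _ in K2.
have v1 : 0 < cross z x1.
  by rewrite (_ : cross _ _ = e1 * dot z z) ?mulr_gt0// /cross /dot !coordE/=; ring.
have v2 : cross z x2 < 0.
  rewrite (_ : cross _ _ = - (e2 * dot z z)) ?oppr_lt0 ?mulr_gt0//.
  by rewrite /cross /dot !coordE/=; ring.
pose S := [set dot z x / cross z x | x in [set x | K x /\ 0 < cross z x]].
have lbS y : K y -> cross z y < 0 -> lbound S (dot z y / cross z y).
  by move=> Ky vy _ [x [Kx vx] <-]; exact: ratio.
have S0 : S !=set0 by exists (dot z x1 / cross z x1), x1.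
pose s := inf S.
have dE x : dot (z.1 + s * z.2, z.2 - s * z.1) x = dot z x - s * cross z x.
  by rewrite /dot /cross/=; ring.
exists (z.1 + s * z.2, z.2 - s * z.1); last first.
  by rewrite dE (_ : cross z z = 0) ?mulr0 ?subr0// /cross; ring.
move=> x Kx; rewrite dE; have [v0|v0|v0] := ltgtP (cross z x) 0.
- rewrite subr_ge0 -ler_ndivrMr//; apply: lb_le_inf => //; exact: lbS.
- rewrite subr_ge0 -ler_pdivlMr//; apply: ge_inf; last by exists x.
  by exists (dot z x2 / cross z x2); exact: lbS.
- by rewrite v0 mulr0 subr0; exact: axis.
Qed.

Lemma core_line K x d : convex K -> core K x ->
  exists2 e, 0 < e & forall t, `|t| <= e -> K (x + t *: d).
Proof.
move=> cK cx; have Kx := core_sub cx.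
have [e1 e10 K1] := cx d; have [e2 e20 K2] := cx (- d).
exists (Num.min e1 e2); first by rewrite lt_min e10.
move=> t; rewrite le_min => /andP[t1 t2].
have [t0|t0] := leP 0 t.
  rewrite ger0_norm// in t1.
  have : 0 <= t / e1 <= 1 by rewrite divr_ge0 ?ler_pdivrMr ?mul1r// ltW.
  move=> /cK/(_ K1 Kx); congr K.
  by apply: coordP; rewrite !coordE; field; lra.
rewrite ltr0_norm// in t2.
have : 0 <= - t / e2 <= 1 by rewrite divr_ge0 ?ler_pdivrMr ?mul1r//; lra.
move=> /cK/(_ K2 Kx); congr K.
by apply: coordP; rewrite !coordE; field; lra.
Qed.

Lemma core_interior K x : convex K -> core K x -> K° x.
Proof.
move=> cK cx.
have [e1 e10 K1] := core_line (1, 0) cK cx.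
have [e2 e20 K2] := core_line (0, 1) cK cx.
apply/nbhs_ballP; exists (Num.min e1 e2 / 2) => /=.
  by rewrite divr_gt0// lt_min e10.
set m := Num.min e1 e2.
have m1 : m <= e1 by rewrite ge_min lexx.
have m2 : m <= e2 by rewrite ge_min lexx orbT.
move=> y [y1 y2]; rewrite /ball/= distrC in y1; rewrite /ball/= distrC in y2.
have h1 : K (x + (2 * (y.1 - x.1)) *: (1, 0)).
  by apply: K1; rewrite normrM ger0_norm//; lra.
have h2 : K (x + (2 * (y.2 - x.2)) *: (0, 1)).
  by apply: K2; rewrite normrM ger0_norm//; lra.
have h12 : 0 <= (2^-1 : R) <= 1 by lra.
have := cK _ _ _ h12 h1 h2; congr K.
by apply: coordP; rewrite !coordE/=; field.
Qed.

Lemma interior_core K x : K° x -> core K x.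
Proof.
move=> /nbhs_ballP[e /= e0 Ke] d.
have N0 : 0 < 1 + `|d.1| + `|d.2|.
  by have [] := (normr_ge0 d.1, normr_ge0 d.2); lra.
exists (e / (1 + `|d.1| + `|d.2|)); first by rewrite divr_gt0.
have aux b : `|b| < 1 + `|d.1| + `|d.2| ->
    `|e / (1 + `|d.1| + `|d.2|) * b| < e.
  move=> h; rewrite normrM ger0_norm ?divr_ge0 1?ltW//.
  by rewrite mulrAC ltr_pdivrMr// ltr_pM2l.
apply: Ke; split; rewrite /ball/= opprD addrA subrr sub0r normrN.
  by apply: aux; have := normr_ge0 d.2; lra.
by apply: aux; have := normr_ge0 d.1; lra.
Qed.

End geometry.

(** * The plane measure and the centroid *)

Section measure.
Context {R : realType}.
Set Implicit Arguments. Unset Strict Implicit. Unset Printing Implicit Defensive.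
Implicit Types (K : set (R * R)) (p q r u v w x y z d : R * R).
Implicit Types (t a b c e : R).
Let T := (measurableTypeR R * measurableTypeR R)%type.

(** An open set is the union of the boxes with rational centre and radius
    1/(n+1) that it contains. *)
Lemma open_measurable2 (U : set (R * R)) : open U -> measurable (U : set T).
Proof.
move=> oU.
pose I := (rat * rat * nat)%type.
pose box (i : I) : set (R * R) :=
  ball (ratr i.1.1 : R) (i.2.+1%:R^-1) `*` ball (ratr i.1.2 : R) (i.2.+1%:R^-1).
pose F i : set T := [set x | box i `<=` U /\ box i x].
suff -> : U = \bigcup_i F i.
  apply: countable_bigcupT_measurable => [|i]; first exact: countableP.
  have [h|h] := pselect (box i `<=` U).
    rewrite (_ : F i = box i); last by apply/seteqP; split=> x; [case|split].
    by apply: measurableX; exact: measurable_ball.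
  by rewrite (_ : F i = set0)//; apply/seteqP; split=> x [].
apply/seteqP; split=> [x Ux|x [i _ [h /h //]]].
have /nbhs_ballP[e /= e0 eU] := open_nbhs_nbhs (conj oU Ux).
have [n [r [rE r0 re]]] :
    exists n (r : R), [/\ r = n.+1%:R^-1, 0 < r & r < e / 2].
  have e20 : 0 < e / 2 by rewrite divr_gt0.
  exists (Num.truncn (e / 2)^-1), (Num.truncn (e / 2)^-1).+1%:R^-1.
  by split; rewrite // ?invr_gt0// invf_plt ?posrE// truncnS_gt.
have r_itv b : b - r < b + r by lra.
have [q1] := rat_in_itvoo (r_itv x.1); have [q2] := rat_in_itvoo (r_itv x.2).
rewrite !in_itv/= => /andP[a2 b2] /andP[a1 b1].
exists (q1, q2, n) => //; rewrite /F /box /= -rE; split; last first.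
  by split; rewrite /ball/= ltr_norml; lra.
move=> y [/= + +]; rewrite /ball/= => h1 h2; apply: eU; split; rewrite /ball/=.
  by move: h1; rewrite !ltr_norml; lra.
by move: h2; rewrite !ltr_norml; lra.
Qed.

Lemma compact_measurable2 K : compact K -> measurable (K : set T).
Proof.
move=> cK; rewrite -[K]setCK; apply: measurableC.
apply: open_measurable2; apply: closed_openC.
by apply: compact_closed => //; exact: norm_hausdorff.
Qed.

Lemma volX (A B : set (measurableTypeR R)) : measurable A -> measurable B ->
  vol (A `*` B) = (lebesgue_measure A * lebesgue_measure B)%E.
Proof. exact: product_measure1E. Qed.

Lemma vol_open_gt0 (U : set T) x : measurable U -> nbhs (x : R * R) U ->
  (0 < vol U)%E.
Proof.
move=> mU /nbhs_ballP[e /= e0 eU].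
pose B : set T := (ball x.1 e : set (measurableTypeR R)) `*` ball x.2 e.
have mB : measurable B by apply: measurableX; exact: measurable_ball.
have : (vol B <= vol U)%E.
  by apply: le_measure; rewrite ?inE// => y [y1 y2]; apply: eU.
apply: lt_le_trans; rewrite volX; try exact: measurable_ball.
rewrite !lebesgue_measure_ball ?ltW// -EFinM lte_fin.
by rewrite mulr_gt0// mulrn_wgt0.
Qed.

Lemma measurable_translate a :
  measurable_fun setT
    ((fun b : R => b + a) : measurableTypeR R -> measurableTypeR R).
Proof. exact: measurable_funD. Qed.

Lemma lebesgue_translate a (A : set (measurableTypeR R)) : measurable A ->
  pushforward lebesgue_measure
    ((fun b : R => b + a) : _ -> measurableTypeR R) A = lebesgue_measure A.
Proof.
move=> mA; have ms := @measurable_translate a.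
apply/esym/lebesgue_measure_unique => //= _ [[b c]] _ <-.
rewrite /pushforward (_ : _ @^-1` _ = `]b - a, c - a]%classic); last first.
  by apply/seteqP; split=> r/=; rewrite !in_itv/=; lra.
rewrite !lebesgue_measure_itv/= !lte_fin ltrD2r; case: ifP => // _.
by rewrite -!EFinB; congr EFin; ring.
Qed.

Lemma measurable_translate2 w :
  measurable_fun setT ((fun x => x + w) : T -> T).
Proof. by apply/measurable_fun_pairP; split; exact: measurable_funD. Qed.

(** By uniqueness of the product measure, from the invariance of the measure
    of the line. *)
Lemma vol_translate w (A : set T) : measurable A ->
  pushforward vol ((fun x => x + w) : T -> T) A = vol A.
Proof.
move=> mA; apply/esym; apply: product_measure_unique => //.
  exact: measurable_translate2.
move=> mt X Y mX mY; have mpre b (Z : set (measurableTypeR R)) : measurable Z ->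
    measurable ((fun c : R => c + b) @^-1` Z : set (measurableTypeR R)).
  by move=> mZ; rewrite -[_ @^-1` _]setTI; exact: measurable_translate.
transitivity (vol (((fun b : R => b + w.1) @^-1` X) `*`
                   ((fun b : R => b + w.2) @^-1` Y))); first by [].
rewrite volX; [|exact: mpre..].
by congr (_ * _)%E; exact: lebesgue_translate.
Qed.

Lemma integrable_translate w (f : R * R -> R) :
  vol.-integrable setT (EFin \o f) ->
  vol.-integrable setT (fun x : T => (f (x + w))%:E).
Proof.
move=> intf; have mt := @measurable_translate2 w.
have [mf foo] := integrableP _ _ _ intf.
apply/integrableP; split.
  exact: (measurableT_comp mf mt).
have mabs : measurable_fun setT (fun x : T => `|(f x)%:E|%E).
  exact: measurableT_comp mf.
have fw := @ge0_integral_pushforward _ _ _ _ _ _ mt vol setT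
  (fun x => `|(f x)%:E|%E) measurableT mabs (fun _ _ => abse_ge0 _).
apply: le_lt_trans foo; rewrite le_eqVlt; apply/orP; left; apply/eqP.
apply: etrans (esym fw) _.
by apply: eq_measure_integral => A mA _; exact: vol_translate.
Qed.

Lemma integral_translate w (f : R * R -> R) :
  vol.-integrable setT (EFin \o f) ->
  (\int[vol]_x (f (x + w))%:E = \int[vol]_x (f x)%:E)%E.
Proof.
move=> intf; have mt := @measurable_translate2 w.
have [mf foo] := integrableP _ _ _ intf.
have /= <- := @integral_pushforward _ _ _ _ R _ mt vol setT _ mf
  (integrable_translate w intf) (@measurableT _ _).
by apply: eq_measure_integral => A mA _; exact: vol_translate.
Qed.

Lemma compact_vol K : compact K -> (vol K < +oo)%E.
Proof.
move=> cK; have mK := compact_measurable2 cK.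
have [M [_ MK]] := compact_bounded cK.
have {}MK x : K x -> `|x.1| <= M + 1 /\ `|x.2| <= M + 1.
  have M1 : M < M + 1 by lra.
  move=> Kx; have := MK _ M1 x Kx; rewrite /Num.norm /= ge_max.
  by move=> /andP[].
pose I : set (measurableTypeR R) := `[- (M + 1), M + 1]%classic.
apply: (@le_lt_trans _ _ (vol (I `*` I))).
  apply: le_measure; rewrite ?inE//.
    by apply: measurableX; exact: measurable_itv.
  move=> x /MK[h1 h2]; split; rewrite /I/= in_itv/=.
    by move: h1; rewrite ler_norml.
  by move: h2; rewrite ler_norml.
rewrite volX; try exact: measurable_itv.
rewrite /I lebesgue_measure_itv /=.
by case: ifP => _; rewrite ?mul0e// -EFinB -EFinM ltry.
Qed.

Lemma compact_integrable K u : compact K ->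
  vol.-integrable (K : set T) (EFin \o dot u).
Proof.
move=> cK; apply: measurable_bounded_integrable.
- exact: compact_measurable2.
- exact: compact_vol.
- apply: measurable_funTS.
  by apply: measurable_funD; apply: measurable_funM => //.
have [M [_ MK]] := compact_bounded cK.
exists (`|u.1| * (M + 1) + `|u.2| * (M + 1)); split; first exact: num_real.
move=> N /ltW MN x Kx; apply: le_trans MN; rewrite /= /dot.
have M1 : M < M + 1 by lra.
have := MK _ M1 x Kx; rewrite /Num.norm /= ge_max => /andP[h1 h2].
rewrite (le_trans (ler_normD _ _))// !normrM.
by apply: lerD; rewrite ler_wpM2l.
Qed.

(** A nonnegative function with zero integral vanishes outside a null set,
    and a neighbourhood of a point is not a null set. *)
Lemma integral_gt0 (g : R * R -> R) (U : set (R * R)) x :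
  vol.-integrable setT (EFin \o g) -> (forall y, 0 <= g y) ->
  nbhs x U -> (forall y, U y -> 0 < g y) -> (\int[vol]_y (g y)%:E != 0)%E.
Proof.
move=> intg g0 xU Ug; have [mg _] := integrableP _ _ _ intg.
apply/eqP => I0.
have : (\int[vol]_y `|(EFin \o g) y| = 0)%E.
  by rewrite -I0; apply: eq_integral => y _ /=; rewrite ger0_norm.
move=> /(ae_eq_integral_abs _ measurableT mg)[N [mN N0 gN]].
have : (0 < vol N)%E.
  apply: (@vol_open_gt0 _ x) => //; apply: filterS xU => y Uy.
  by apply: gN => /= /(_ I)[] /eqP; rewrite gt_eqF// Ug.
by rewrite N0 ltxx.
Qed.

Lemma continuous_dot u : continuous (dot u).
Proof.
by move=> x; apply: cvgD; apply: cvgM;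
  [exact: cvg_cst|exact: cvg_fst|exact: cvg_cst|exact: cvg_snd].
Qed.

Lemma open_dot u a b : open [set x | a < dot u x < b].
Proof.
rewrite (_ : mkset _ = dot u @^-1` `]a, b[); last first.
  by apply/seteqP; split=> x /=; rewrite in_itv.
apply: open_comp; last exact: interval_open.
by move=> x _; exact: continuous_dot.
Qed.

Lemma centroid_integral K u : compact K -> (0 < vol K)%E -> centroid K = 0 ->
  (\int[vol]_x ((dot u \_ K) x)%:E = 0)%E.
Proof.
move=> cK K0; rewrite /centroid => cK0.
have fK : fine (vol K) != 0.
  by rewrite gt_eqF// fine_gt0// K0 compact_vol.
have mK := compact_measurable2 cK.
have intd v : vol.-integrable (K : set T) (EFin \o dot v).
  exact: compact_integrable.
have E1 : \int[vol]_(x in (K : set T)) x.1 = 0.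
  have := congr1 fst cK0; rewrite /= => /eqP.
  by rewrite scaler_eq0 invr_eq0 (negPf fK) => /eqP.
have E2 : \int[vol]_(x in (K : set T)) x.2 = 0.
  have := congr1 snd cK0; rewrite /= => /eqP.
  by rewrite scaler_eq0 invr_eq0 (negPf fK) => /eqP.
have i1 : vol.-integrable (K : set T) (fun x : T => (x.1 : R)%:E).
  apply: eq_integrable (intd (1, 0)) => // x _.
  by rewrite /= /dot mul1r mul0r addr0.
have i2 : vol.-integrable (K : set T) (fun x : T => (x.2 : R)%:E).
  apply: eq_integrable (intd (0, 1)) => // x _.
  by rewrite /= /dot mul1r mul0r add0r.
have : \int[vol]_(x in (K : set T)) dot u x = 0.
  rewrite /dot RintegralD//;
    [|exact: (integrableZl mK u.1 i1)|exact: (integrableZl mK u.2 i2)].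
  by rewrite !RintegralZl// E1 E2 !mulr0 addr0.
rewrite /Rintegral => h.
have := integrable_fin_num mK (intd u) => /fineK.
rewrite h => I0.
transitivity (\int[vol]_(x in (K : set T)) (dot u x)%:E)%E; last by [].
by rewrite [RHS]integral_mkcond; apply: eq_integral => x _; rewrite restrict_EFin.
Qed.

(** A linear form that is nonnegative on [K] has zero integral over [K], so it
    cannot be positive around an interior point. *)
Lemma centroid_support K z u : compact K -> (0 < vol K)%E -> centroid K = 0 ->
  (forall x, K x -> 0 <= dot u x) -> K° z -> dot u z <= 0.
Proof.
move=> cK K0 cK0 Ku Kz; rewrite leNgt; apply/negP => uz.
have mK := compact_measurable2 cK.
have /eqP := centroid_integral u cK K0 cK0; apply/negP.
apply: (@integral_gt0 _ (K `&` [set x | 0 < dot u x < dot u z + 1]) z).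
- have /(integrable_mkcond _ mK) := compact_integrable u cK.
  by rewrite restrict_EFin.
- by move=> y; rewrite patchE; case: ifPn => // /set_mem; exact: Ku.
- apply: filterI => //; apply: open_nbhs_nbhs; split; first exact: open_dot.
  by rewrite /= uz; lra.
- by move=> y [Ky /andP[uy _]]; rewrite patchE mem_set.
Qed.

(** Suppose that [x + w] is in [K] and [dot u x <= 1/2] for all [x] in [K] with
    [dot u x > 0].  The translation by [w] moves the part of [K] where the form
    is positive into the part where it is negative, changing the value [s] into
    [s - 1 <= - s].  Adding to the form on [K] the difference between the
    translate of its positive part and this part leaves the integral unchanged
    and gives a nonpositive function, negative around points of [K] where the
    form is slightly negative; so the integral could not be zero. *)
Lemma centroid_translate K u w : compact K -> (0 < vol K)%E ->
  centroid K = 0 -> K° 0 -> dot u w = - 1 ->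
  exists2 x, K x & 0 < dot u x /\ ~ (dot u x <= 2^-1 /\ K (x + w)).
Proof.
move=> cK K0 cK0 K00 uw; apply/not_exists2P => /= h.
have {}h x : K x -> 0 < dot u x -> dot u x <= 2^-1 /\ K (x + w).
  by move=> Kx ux; have [//|H] := h x; apply: contrapT => ?; apply: H.
have mK := compact_measurable2 cK.
have uB x : dot u (x - w) = dot u x + 1.
  by rewrite /dot !coordE; move: uw; rewrite /dot; lra.
have oV : nbhs (0 : R * R) (K° `&` [set x | - 2^-1 < dot u x < 1]).
  apply: filterI; first exact: nbhs_interior.
  apply: open_nbhs_nbhs; split; first exact: open_dot.
  by rewrite /dot/= !mulr0; lra.
have [e e0 [Kew /= uew]] := interior_core oV w.
have {}uew : - 2^-1 < dot u (0 + e *: w) < 0.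
  rewrite (_ : dot u _ = - e) in uew *; first lra.
  by rewrite /dot !coordE; move: uw; rewrite /dot => uw; nra.
pose P := K `&` [set x | 0 < dot u x].
pose g1 := dot u \_ P.
(* This is the opposite of the function described above. *)
pose g x := g1 x - g1 (x - w) - (dot u \_ K) x.
have mP : measurable (P : set T).
  apply: measurableI => //; apply: open_measurable2.
  rewrite (_ : mkset _ = \bigcup_n [set x | 0 < dot u x < n%:R]).
    by apply: bigcup_open => n _; exact: open_dot.
  apply/seteqP; split=> x /=; last by move=> [n _ /=] /andP[].
  move=> ux; exists (Num.truncn (dot u x)).+1 => //=.
  by rewrite ux truncnS_gt.
have iK : vol.-integrable setT (EFin \o (dot u \_ K)).
  have /(integrable_mkcond _ mK) := compact_integrable u cK.
  by rewrite restrict_EFin.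
have i1 : vol.-integrable setT (EFin \o g1).
  have : vol.-integrable (P : set T) (EFin \o dot u).
    apply: integrableS (compact_integrable u cK) => //.
    by move=> x [].
  by move=> /(integrable_mkcond _ mP); rewrite restrict_EFin.
have i2 := integrable_translate (- w) i1.
have gK x : K x -> (dot u \_ K) x = dot u x by move=> ?; rewrite patchE mem_set.
have gnK x : ~ K x -> (dot u \_ K) x = 0.
  by move=> ?; rewrite patchE memNset.
have g1P x : P x -> g1 x = dot u x by move=> ?; rewrite /g1 patchE mem_set.
have g1nP x : ~ P x -> g1 x = 0 by move=> ?; rewrite /g1 patchE memNset.
have neg x : K x -> - 2^-1 < dot u x < 0 -> 0 < g x.
  move=> Kx ux; rewrite /g gK// !g1nP; first lra.
    by move=> [/h]; rewrite /= uB => h1 /h1[]; lra.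
  by move=> []/=; lra.
have : (\int[vol]_x (g x)%:E != 0)%E.
  apply: (@integral_gt0 _ (K `&` [set x | - 2^-1 < dot u x < 0]) (0 + e *: w)).
  - have i3 : vol.-integrable setT (fun x : T => (g1 x)%:E - (g1 (x - w))%:E)%E.
      exact: integrableB.
    exact: integrableB i3 iK.
  - move=> x; rewrite /g.
    have [Pxw|Pxw] := pselect (P (x - w)).
      have [/h] := Pxw; rewrite /= uB subrK => h1 /[dup] h2 /h1[h3 Kx].
      rewrite gK// (g1P _ Pxw) uB g1nP; first lra.
      by move=> []/=; lra.
    rewrite (g1nP _ Pxw) subr0.
    have [Kx|Kx] := pselect (K x); last first.
      by rewrite gnK// g1nP ?subr0// => -[].
    rewrite gK//; have [Px|Px] := pselect (P x); first by rewrite g1P// subrr.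
    rewrite g1nP// sub0r oppr_ge0 leNgt; apply/negP => ux; exact: Px.
  - apply: filterI => //; apply: open_nbhs_nbhs; split=> //; exact: open_dot.
  - by move=> y [Ky uy]; exact: neg.
apply/negP; rewrite negbK.
have -> : (\int[vol]_x (g x)%:E = \int[vol]_x ((g1 x)%:E - (g1 (x - w))%:E) -
    \int[vol]_x ((dot u \_ K) x)%:E)%E.
  by rewrite -integralB//; exact: integrableB.
rewrite centroid_integral// sube0 integralB// integral_translate// subee//.
exact: integrable_fin_num.
Qed.

End measure.

(** * Counting lattice points *)

Section lattice.
Context {R : realType}.
Set Implicit Arguments. Unset Strict Implicit. Unset Printing Implicit Defensive.
Implicit Types (K L : set (R * R)) (u v w x y d : R * R) (p q z e g : int * int).
Implicit Types (t a b c : R) (i j k m n : int).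

Lemma int_ptE z : ((int_pt z : R * R).1 = z.1%:~R) *
  ((int_pt z : R * R).2 = z.2%:~R).
Proof. by []. Qed.

Lemma int_pt_inj : injective (@int_pt R).
Proof. by move=> [a b] [c d] [] /intr_inj -> /intr_inj ->. Qed.

Lemma Z2_card K : (K `&` @Z2 R) #= [set z | K (int_pt z)].
Proof.
rewrite (_ : K `&` _ = int_pt @` [set z | K (int_pt z)]).
  by apply: inj_card_eq => z z' h h'; exact: int_pt_inj.
apply/seteqP; split=> [x [Kz [z h zE]]|x [z Kz <-]].
  by exists z => //=; rewrite zE.
by split=> //; exists z.
Qed.

Lemma card_Z2_le K (n' : nat) :
  ([set z | K (int_pt z)] #<= `I_n') = (K `&` Z2 #<= `I_n').
Proof. by apply/esym/card_le_eql/Z2_card. Qed.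

Lemma eq_mod3 i j : (i = j %[mod 3])%Z -> exists k, j = i + 3 * k.
Proof.
by move/eqP; rewrite eq_sym eqz_mod_dvd => /dvdzP[k jik]; exists k; lia.
Qed.

(** There are 9 residues modulo 3. *)
Lemma few_residues K :
  (forall p q, K (int_pt p) -> K (int_pt q) ->
    (p.1 = q.1 %[mod 3])%Z -> (p.2 = q.2 %[mod 3])%Z -> p = q) ->
  K `&` Z2 #<= `I_9.
Proof.
move=> inj; rewrite -card_Z2_le.
pose f z := (`|(z.1 %% 3)%Z| * 3 + `|(z.2 %% 3)%Z|)%N.
have finj : {in [set z | K (int_pt z)] &, injective f}.
  move=> p q /set_mem/= Kp /set_mem/= Kq; rewrite /f => pq.
  have h n : (0 <= n %% 3 < 3)%Z.
    by rewrite modz_ge0// ltz_pmod.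
  have [] := (h p.1, h p.2); have [] := (h q.1, h q.2) => h1 h2 h3 h4.
  by apply: inj => //; lia.
rewrite -(card_le_eql (inj_card_eq finj)).
apply: subset_card_le => _ [z _ <-]; rewrite /f/=.
have h n : (0 <= n %% 3 < 3)%Z by rewrite modz_ge0// ltz_pmod.
by have [] := (h z.1, h z.2) => h1 h2; lia.
Qed.

Lemma card_seq_le (T : eqType) (A : set T) (s : seq T) (n' : nat) :
  (forall x : T, A x -> x \in s) -> (size s <= n')%N -> A #<= `I_n'.
Proof.
move=> As sn; rewrite -card_le_II in sn; apply: card_le_trans sn.
case: s As => [|x0 s] As.
  rewrite (_ : A = set0) ?card_ge0//; by apply/seteqP; split=> r // /As.
apply: (@card_le_trans _ _ _ (nth x0 (x0 :: s) @` `I_(size s).+1)).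
  apply: subset_card_le => r /As rs; exists (index r (x0 :: s)).
    by move: rs; rewrite /= -index_mem.
  by rewrite nth_index.
exact: card_image_le.
Qed.

Lemma card_seq_eq (T : eqType) (s : seq T) : uniq s -> [set` s] #= `I_(size s).
Proof.
case: s => [|x0 s] us.
  by rewrite (_ : [set` _] = set0) ?II0//; apply/seteqP; split.
rewrite (_ : [set` _] = nth x0 (x0 :: s) @` `I_(size s).+1).
  apply: inj_card_eq => i' j' /set_mem/= si /set_mem/= sj /eqP.
  by rewrite nth_uniq// => /eqP.
apply/seteqP; split=> [r rs|r [i' si <-]]; last exact: mem_nth.
exists (index r (x0 :: s)); last by rewrite nth_index.
by move: rs; rewrite /= -index_mem.
Qed.

(** * Unimodular coordinates *)

Definition crossZ e g : int := e.1 * g.2 - e.2 * g.1.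
Definition combZ e g z : int * int :=
  (z.1 * e.1 + z.2 * g.1, z.1 * e.2 + z.2 * g.2).

(** The point with coordinates [x] in the basis [e], [g]; in what follows
    [crossZ e g = 1], so that this basis generates the lattice and
    [frame e g @^-1` K] is [K] in unimodular coordinates. *)
Definition frame e g x : R * R := x.1 *: int_pt e + x.2 *: int_pt g.

Lemma frame_int_pt e g z : frame e g (int_pt z) = int_pt (combZ e g z).
Proof.
by apply: coordP; rewrite /frame !coordE !int_ptE/= !rmorphD/= !rmorphM.
Qed.

Lemma frame_lin e g x y t : frame e g (x + t *: y) =
  frame e g x + t *: frame e g y.
Proof. by apply: coordP; rewrite /frame !coordE; ring. Qed.

Lemma frame_comb e g x y t b :
  frame e g (t *: x + b *: y) = t *: frame e g x + b *: frame e g y.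
Proof. by apply: coordP; rewrite /frame !coordE; ring. Qed.

Definition coframe e g x : R * R := (cross x (int_pt g), cross (int_pt e) x).

Lemma crossZR e g : crossZ e g = 1 ->
  e.1%:~R * g.2%:~R - e.2%:~R * g.1%:~R = 1 :> R.
Proof. by rewrite -!rmorphM -rmorphB/= /crossZ => ->. Qed.

Lemma coframeK e g x : crossZ e g = 1 -> frame e g (coframe e g x) = x.
Proof.
move=> /crossZR h; rewrite /frame /coframe /cross; apply: coordP;
  rewrite !coordE !int_ptE/=.
  transitivity (x.1 * (e.1%:~R * g.2%:~R - e.2%:~R * g.1%:~R)).
    by ring.
  by rewrite h mulr1.
transitivity (x.2 * (e.1%:~R * g.2%:~R - e.2%:~R * g.1%:~R)).
  by ring.
by rewrite h mulr1.
Qed.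

Lemma frameK e g x : crossZ e g = 1 -> coframe e g (frame e g x) = x.
Proof.
move=> /crossZR h; rewrite /frame /coframe /cross; apply: coordP;
  rewrite !coordE !int_ptE/=.
  transitivity (x.1 * (e.1%:~R * g.2%:~R - e.2%:~R * g.1%:~R)).
    by ring.
  by rewrite h mulr1.
transitivity (x.2 * (e.1%:~R * g.2%:~R - e.2%:~R * g.1%:~R)).
  by ring.
by rewrite h mulr1.
Qed.

Lemma convex_frame e g K : convex K -> convex (frame e g @^-1` K).
Proof. by move=> cK x y t t01 Kx Ky; rewrite /= frame_comb; exact: cK. Qed.

Lemma core_frame e g K x : crossZ e g = 1 ->
  core (frame e g @^-1` K) x <-> core K (frame e g x).
Proof.
move=> eg; split=> cx d.
  have [r r0] := cx (coframe e g d).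
  by rewrite /= frame_lin coframeK//; exists r.
by have [r r0 Kr] := cx (frame e g d); exists r; rewrite //= frame_lin.
Qed.

Definition hollow K := [/\ convex K, core K 0 &
  forall z, core K (int_pt z) -> z = (0, 0)].

Lemma hollow_frame e g K : crossZ e g = 1 -> hollow K ->
  hollow (frame e g @^-1` K).
Proof.
move=> eg [cK K0 hK]; split; first exact: convex_frame.
  apply/core_frame => //; suff -> : frame e g 0 = 0 by [].
  by apply: coordP; rewrite /frame !coordE; ring.
move=> z /(core_frame _ _ eg); rewrite frame_int_pt => /hK.
move: eg; case: e g z => [a b] [c d] [x y]; rewrite /crossZ /combZ/= => eg.
move=> [h1 h2].
have -> : x = x * (a * d - b * c) by rewrite eg mulr1.
have -> : y = y * (a * d - b * c) by rewrite eg mulr1.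
congr (_, _).
  transitivity ((x * a + y * c) * d - (x * b + y * d) * c); first ring.
  by rewrite h1 h2; ring.
transitivity ((x * b + y * d) * a - (x * a + y * c) * b); first ring.
by rewrite h1 h2; ring.
Qed.

Lemma frame_lattice_preimage e g z : crossZ e g = 1 ->
  exists z', z = combZ e g z'.
Proof.
move=> eg; exists (z.1 * g.2 - z.2 * g.1, e.1 * z.2 - e.2 * z.1).
move: eg; case: e g z => [a b] [c d] [x y]; rewrite /crossZ /combZ/= => eg.
congr (_, _).
  by rewrite -[LHS]mulr1 -eg; ring.
by rewrite -[LHS]mulr1 -eg; ring.
Qed.

Lemma card_frame e g K (n' : nat) : crossZ e g = 1 ->
  [set z | K (frame e g (int_pt z))] #<= `I_n' -> K `&` Z2 #<= `I_n'.
Proof.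
move=> eg; rewrite -card_Z2_le; apply: card_le_trans.
apply: (@card_le_trans _ _ _ (combZ e g @` [set z | K (frame e g (int_pt z))])).
  apply: subset_card_le => z /= Kz; have [z' zE] := frame_lattice_preimage z eg.
  by exists z' => //=; rewrite frame_int_pt -zE.
exact: card_image_le.
Qed.

(** * Boundary edges at lattice distance one *)

(** Points of [K] strictly on both sides of the line would make the point on
    the segment interior [core_between]. *)
Lemma supporting_line K x y t : convex K -> K x -> K y -> 0 < t < 1 ->
  ~ core K (t *: x + (1 - t) *: y) ->
  (forall u, K u -> 0 <= cross (y - x) (u - x)) \/
  (forall u, K u -> 0 <= cross (x - y) (u - y)).
Proof.
move=> cK Kx Ky t01 nc; apply/or_asboolP; rewrite -[_ || _]negbK negb_or.
apply/negP => /andP[/asboolPn/existsNP[v /not_implyP[Kv /negP]]].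
rewrite -ltNge => v0 /asboolPn/existsNP[u /not_implyP[Ku /negP]].
rewrite -ltNge => u0; apply: nc; apply: (@core_between _ _ _ _ u v) => //.
by move: u0; rewrite /cross !coordE; lra.
Qed.

Lemma convex_row L a b c t : convex L -> L (a, t) -> L (b, t) -> a <= c <= b ->
  L (c, t).
Proof.
move=> cL La Lb /andP[ac cb].
have [ab|ab] := eqVneq a b; first by have -> : c = a by lra.
have ab0 : 0 < b - a by rewrite subr_gt0 lt_neqAle ab; lra.
have h : 0 <= (b - c) / (b - a) <= 1.
  by rewrite divr_ge0 ?ler_pdivrMr//; lra.
have := cL _ _ _ h La Lb; congr L.
by apply: coordP; rewrite !coordE/=; field; lra.
Qed.

(** Adding a multiple of [e] to [g] shears the coordinates and fixes the row
    of height 0. *)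
Lemma frame_shear e g k x : frame e (g.1 + k * e.1, g.2 + k * e.2) x =
  frame e g (x.1 + k%:~R * x.2, x.2).
Proof.
by apply: coordP; rewrite /frame !coordE !int_ptE/= !rmorphD/= !rmorphM/=; ring.
Qed.

Lemma crossZ_shear e g k : crossZ e (g.1 + k * e.1, g.2 + k * e.2) = crossZ e g.
Proof. by rewrite /crossZ/=; ring. Qed.

(** Beyond this range, the lattice point (1,0) or (-1,0) would lie strictly
    between the origin and the given point. *)
Lemma row0 L a : hollow L -> L (a, 0) -> -1 <= a <= 1.
Proof.
move=> [cL L0 hL] La; apply/andP; split; rewrite leNgt; apply/negP => a1.
  have h : 0 < 1 - (- a)^-1 <= 1.
    by rewrite gerBl subr_gt0 invf_lt1 ?invr_ge0; lra.
  have := core_segment cL L0 La h.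
  rewrite (_ : _ + _ = int_pt (-1, 0)); first by move=> /hL.
  by apply: coordP; rewrite !coordE/=; field; lra.
have h : 0 < 1 - a^-1 <= 1.
  by rewrite gerBl subr_gt0 invf_lt1 ?invr_ge0; lra.
have := core_segment cL L0 La h.
rewrite (_ : _ + _ = int_pt (1, 0)); first by move=> /hL.
by apply: coordP; rewrite !coordE/=; field; lra.
Qed.

(** The segment from [(b, -1)] to [x] crosses the row of height 0 at abscissa
    [(x.1 + x.2 * b) / (1 + x.2)], which [row0] confines to [-1, 1]. *)
Lemma crossing L b x : hollow L -> L (b, -1) -> L x -> 0 <= x.2 ->
  - (1 + x.2) <= x.1 + x.2 * b <= 1 + x.2.
Proof.
move=> hL Lb Lx x0; have [cL _ _] := hL.
have h : 0 <= (1 + x.2)^-1 <= 1 by rewrite invr_ge0 invf_le1; lra.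
have := cL _ _ _ h Lx Lb.
rewrite (_ : _ + _ = ((x.1 + x.2 * b) / (1 + x.2), 0)); last first.
  by apply: coordP; rewrite !coordE/=; field; lra.
by move=> /(row0 hL); rewrite ler_pdivlMr ?ler_pdivrMr; lra.
Qed.

(** The edge starts at abscissa -1 because this can be achieved by a shear, and
    because it is the position of the bottom edge of [S2]. *)
Definition bottom_edge L b :=
  [/\ forall x, L x -> -1 <= x.2, L (-1, -1) & L (b, -1)].

(** With [q - p] equal to [3 * k] times a primitive vector [e], the points [p]
    and [q] are [(a, - h)] and [(a + 3 * k, - h)] in the coordinates of a basis
    [e], [g].  If [h > 1], the row of height [1 - h] meets the triangle with
    vertices the origin, [p] and [q] in a segment of length
    [3 * k * (h - 1) / h >= 3 / 2], which contains a lattice point; this point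
    is interior, being on a segment from the origin to a point of [K]. *)
Lemma height1_edge K p q : hollow K -> K (int_pt p) -> K (int_pt q) -> p != q ->
  (p.1 = q.1 %[mod 3])%Z -> (p.2 = q.2 %[mod 3])%Z ->
  (forall u, K u -> 0 <= cross (int_pt q - int_pt p) (u - int_pt p)) ->
  exists e g, crossZ e g = 1 /\ bottom_edge (frame e g @^-1` K) 2.
Proof.
move=> hK Kp Kq pq pq1 pq2 Ku.
have [m qm] := eq_mod3 pq1; have [n qn] := eq_mod3 pq2.
have [k [e [g [k0 me ne eg]]]] : exists k e g,
    [/\ 0 < k, m = k * e.1, n = k * e.2 & crossZ e g = 1].
  have [s [r srE]] := Bezoutz m n.
  have /dvdzP[a ma] := dvdz_gcdl m n; have /dvdzP[b nb] := dvdz_gcdr m n.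
  have k0 : 0 < gcdz m n.
    rewrite lt_neqAle eq_sym gcdz_eq0; apply/andP; split=> //.
    apply: contra pq => /andP[/eqP m0 /eqP n0]; rewrite m0 n0 in qm qn.
    by rewrite -pair_eqE /pair_eq/=; apply/andP; split; apply/eqP; lia.
  exists (gcdz m n), (a, b), (- r, s); rewrite /crossZ/=.
  split; rewrite ?[gcdz _ _ * _]mulrC//.
  apply: (@mulIf _ (gcdz m n)); first by rewrite gt_eqF.
  transitivity (s * (a * gcdz m n) + r * (b * gcdz m n)); first ring.
  by rewrite -ma -nb mul1r.
pose L := frame e g @^-1` K.
have [cL L0 hL] : hollow L by exact: hollow_frame.
have [a [h [La Lb Lh]]] : exists a h : int,
    [/\ L (a%:~R, - h%:~R), L ((a + 3 * k)%:~R, - h%:~R) &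
        forall x, L x -> - h%:~R <= x.2].
  have pE : frame e g ((crossZ p g)%:~R, - (- crossZ e p)%:~R) =
      int_pt p :> R * R.
    transitivity (frame e g (coframe e g (int_pt p : R * R)));
      last exact: coframeK.
    rewrite /coframe /cross !int_ptE -!rmorphM -!rmorphB.
    by rewrite rmorphN opprK.
  have qE : frame e g ((crossZ p g + 3 * k)%:~R, - (- crossZ e p)%:~R) =
      int_pt q :> R * R.
    transitivity (frame e g (coframe e g (int_pt q : R * R)));
      last exact: coframeK.
    rewrite /coframe /cross !int_ptE -!rmorphM -!rmorphB.
    congr (frame _ _ (_%:~R, _)).
      rewrite qm qn me ne /crossZ; move: eg; rewrite /crossZ => eg.
      transitivity (p.1 * g.2 - p.2 * g.1 + 3 * k * (e.1 * g.2 - e.2 * g.1)).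
        by rewrite eg mulr1.
      ring.
    by rewrite -rmorphN opprK qm qn me ne /crossZ; congr _%:~R; ring.
  exists (crossZ p g), (- crossZ e p); split; rewrite /L/= ?pE ?qE//.
  move=> x Kx; have := Ku _ Kx.
  have k0R : 0 < k%:~R :> R by rewrite ltr0z.
  have -> : cross (int_pt q - int_pt p) (frame e g x - int_pt p) =
     3 * k%:~R * (x.2 * (e.1%:~R * g.2%:~R - e.2%:~R * g.1%:~R) - (crossZ e p)%:~R).
    rewrite /cross /frame !coordE !int_ptE qm qn me ne /crossZ.
    by rewrite !(rmorphB, rmorphD, rmorphM) /=; ring.
  rewrite crossZR// mulr1 rmorphN opprK pmulr_rge0 ?mulr_gt0// subr_ge0.
  by [].
have h0 : 0 < h.
  have [r r0 Lr] := L0 (0, -1); have := Lh _ Lr; rewrite !coordE/=.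
  by rewrite -(@ltr0z R); lra.
have h1 : h = 1.
  apply/eqP; rewrite eq_le -[1 <= h]/(0 < h) h0 andbT leNgt; apply/negP => h2.
  (* The least integer [i] such that [i * h >= a * (h - 1)]. *)
  pose i := ((a * (h - 1) + (h - 1)) %/ h)%Z.
  have hi : a * (h - 1) <= i * h <= a * (h - 1) + (h - 1).
    have := divz_eq (a * (h - 1) + (h - 1)) h; rewrite -/i.
    have := ltz_pmod (a * (h - 1) + (h - 1)) h0.
    have := modz_ge0 (a * (h - 1) + (h - 1)) (lt0r_neq0 h0).
    by lia.
  have h1R : 1 < h%:~R :> R by rewrite ltr1z.
  have [iR1 iR2] : a%:~R * (h%:~R - 1) <= i%:~R * h%:~R :> R /\
      i%:~R * h%:~R <= (a%:~R + 1) * (h%:~R - 1) :> R.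
    by move: hi; rewrite -!(ler_int R) !(rmorphD, rmorphM, rmorphB)/=; lra.
  have Li : L (i%:~R * h%:~R / (h%:~R - 1), - h%:~R).
    apply: (convex_row cL La Lb); rewrite ler_pdivlMr ?ler_pdivrMr ?subr_gt0//.
    have k1 : 1 <= k%:~R :> R by rewrite ler1z.
    rewrite iR1 (le_trans iR2)// rmorphD rmorphM/= ler_wpM2r; lra.
  have t0 : 0 < h%:~R^-1 :> R by rewrite invr_gt0; lra.
  have t1 : h%:~R^-1 <= 1 :> R by rewrite invf_le1; lra.
  have := core_segment cL L0 Li (introT andP (conj t0 t1)).
  rewrite (_ : _ + _ = int_pt (i, 1 - h)).
    by move=> /hL[_]; lia.
  apply: coordP; rewrite !coordE !int_ptE/= ?rmorphB/=; field.
    by rewrite subr_eq0 !gt_eqF// (lt_trans _ h1R).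
  by rewrite gt_eqF// (lt_trans _ h1R).
subst h; exists e, (g.1 + (-1 - a) * e.1, g.2 + (-1 - a) * e.2).
split; first by rewrite crossZ_shear.
have aE (b : R) : L (a%:~R + 1 + b, -1) ->
    K (frame e (g.1 + (-1 - a) * e.1, g.2 + (-1 - a) * e.2) (b, -1)).
  rewrite /L/= frame_shear/=; congr (K (frame _ _ (_, _))).
  by rewrite rmorphB/=; ring.
have k1 : 1 <= k%:~R :> R by rewrite ler1z.
split=> [x /= Kx||].
- by have := Lh (x.1 + (-1 - a)%:~R * x.2, x.2); apply; rewrite /L/= -frame_shear.
- by apply: aE; have := La; rewrite addrK.
- by apply: aE; apply: (convex_row cL La Lb); rewrite rmorphD rmorphM/=; lra.
Qed.

(** After a shear the edge goes from (-3,-1) to (3,-1).  The bounds of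
    [crossing] for its two ends give [|x| <= 1 - 2 y] at heights [y > 0], so
    that [y <= 1/2] and that the translate by (0,-1) is in the triangle with
    vertices the origin and the two ends. *)
Lemma bottom_edge_lt6 K e g : convex_body K -> centroid K = 0 -> hollow K ->
  crossZ e g = 1 -> ~ bottom_edge (frame e g @^-1` K) 5.
Proof.
move=> [cK _ K0] cK0 hK eg [_ Lm1 L5].
pose g' := (g.1 + (- 2) * e.1, g.2 + (- 2) * e.2).
have eg' : crossZ e g' = 1 by rewrite crossZ_shear.
pose L := frame e g' @^-1` K.
have hL : hollow L by exact: hollow_frame.
have [cvL L0 _] := hL.
have La : L (-3, -1).
  rewrite /L/= frame_shear; move: Lm1; congr (K (frame _ _ (_, _))).
  by rewrite /= rmorphN/=; ring.
have Lb : L (3, -1).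
  rewrite /L/= frame_shear; move: L5; congr (K (frame _ _ (_, _))).
  by rewrite /= rmorphN/=; ring.
have Ki : K° 0 by apply: core_interior; case: hK.
pose u : R * R := (- e.2%:~R, e.1%:~R).
have uE x : dot u x = (coframe e g' x).2.
  by rewrite /dot /coframe /cross !int_ptE/=; ring.
have [|x Kx] := @centroid_translate R K u (frame e g' (0, -1)) cK K0 cK0 Ki.
  by rewrite uE frameK.
rewrite uE; set y := coframe e g' x.
have Ly : L y by rewrite /L /= coframeK.
move=> [y0]; apply.
have /andP[_ h1] := crossing hL Lb Ly (ltW y0).
have /andP[h2 _] := crossing hL La Ly (ltW y0).
split; first lra.
have : L (y + (0, -1)).
  have := @convex3 _ L 0 (-3, -1) (3, -1) y.2 ((1 - y.2 - y.1 / 3) / 2)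
    ((1 - y.2 + y.1 / 3) / 2) cvL (core_sub L0) La Lb.
  rewrite (_ : _ + _ = y + (0, -1)); first by apply; lra.
  by apply: coordP; rewrite !coordE/=; field.
rewrite /L/= -[(0, -1)]scale1r frame_lin /y coframeK//.
by rewrite !scale1r.
Qed.

(** Each shear by one unit lengthens by one the part of the edge that starts at
    abscissa -1, as long as the lattice point (-2,-1) is in the set.  The known
    length is [6 - m'], so that [m'] bounds the number of steps left before
    [bottom_edge_lt6] gives a contradiction. *)
Lemma normalized_edge K (m' : nat) e g :
  convex_body K -> centroid K = 0 -> hollow K -> crossZ e g = 1 -> (m' <= 3)%N ->
  bottom_edge (frame e g @^-1` K) (5 - m'%:R) ->
  exists g', crossZ e g' = 1 /\ bottom_edge (frame e g' @^-1` K) 2 /\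
    ~ K (frame e g' (-2, -1)).
Proof.
move=> bK cK0 hK; have [cK _ _] := hK.
elim: m' g => [|m IH] g eg m3 [Lb La Lc].
  by rewrite subr0 in Lc; case: (bottom_edge_lt6 bK cK0 hK eg).
have m0R : 0 <= m%:R :> R by exact: ler0n.
have m2R : m%:R <= 2 :> R by rewrite (ler_nat R m 2).
have cL := @convex_frame e g _ cK.
have L2 : (frame e g @^-1` K) (2, -1).
  by apply: (convex_row cL La Lc); rewrite -natr1; lra.
have [La'|La'] := pselect (K (frame e g (-2, -1))); last first.
  by exists g.
apply: (IH (g.1 + 1 * e.1, g.2 + 1 * e.2)); first by rewrite crossZ_shear.
  exact: ltnW.
split=> [x /=||]; rewrite ?frame_shear.
- by move=> /Lb.
- move: La'; rewrite /= frame_shear; congr (K (frame _ _ (_, _))).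
  by rewrite /=; ring.
- move: Lc; rewrite /= frame_shear -natr1; congr (K (frame _ _ (_, _))).
  by rewrite /=; ring.
Qed.

(** * Lattice points above a boundary edge *)

(** The points (-1,0) and (0,1) lie strictly inside the edges of [S2] other
    than the bottom one, and they would be interior to [L] if [L] had a point
    beyond these edges. *)
Lemma hollow_S2 L : hollow L -> L (-1, -1) -> L (2, -1) -> L (-1, 2) ->
  (forall x, L x -> -1 <= x.2) -> L = S2.
Proof.
move=> [cL L0 hL] La Lb Lc Ly; rewrite S2E.
have a3 : 0 < (3^-1 : R) < 1 by rewrite invr_gt0 invf_lt1; lra.
apply/seteqP; split=> [x Lx|x [h1 h2 h3]]; last first.
  have := @convex3 _ L (-1, -1) (2, -1) (-1, 2) ((1 - x.1 - x.2) / 3)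
    ((x.1 + 1) / 3) ((x.2 + 1) / 3) cL La Lb Lc.
  rewrite (_ : _ + _ = x); first by apply; lra.
  by apply: coordP; rewrite !coordE/=; field.
split; [|exact: Ly|]; rewrite leNgt; apply/negP => xn.
  have := @core_between _ L (-1, 2) (-1, -1) (2, -1) x _ cL Lc La Lb Lx a3.
  rewrite (_ : 3^-1 *: _ + _ = int_pt (-1, 0)); last first.
    by apply: coordP; rewrite !coordE !int_ptE/=; field.
  rewrite /cross !coordE/= => H.
  by suff : ((-1, 0) : int * int) = (0, 0) by []; apply/hL/H; lra.
have := @core_between _ L (2, -1) (-1, 2) (-1, -1) x 3^-1 cL Lb Lc La Lx a3.
rewrite (_ : 3^-1 *: _ + _ = int_pt (0, 1)); last first.
  by apply: coordP; rewrite !coordE !int_ptE/=; field.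
rewrite /cross !coordE/= => H.
by suff : ((0, 1) : int * int) = (0, 0) by []; apply/hL/H; lra.
Qed.

(** Let [b] be the largest abscissa of a lattice point of the bottom row.  The
    bounds of [crossing] for (-1,-1) and [(b, -1)] read [i >= -1] and
    [i + j * b <= 1 + j] for a lattice point [(i, j)] with [j >= 0].  The three
    lists below contain the solutions for [b = 2], 3 and 4; for [b = 2] the
    point (-1,2) is set apart. *)
Lemma edge_count L : hollow L -> bottom_edge L 2 -> ~ L (-2, -1) ->
  ~ L (5, -1) -> [set z | L (int_pt z)] #<= `I_9 \/ L = S2.
Proof.
move=> hL [Ly La Lb] Lc Ld; have [cL _ _] := hL.
have intE i j : int_pt (i, j) = (i%:~R, j%:~R) :> R * R by [].
have row z : L (int_pt z) -> -1 <= z.2.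
  by move=> /Ly; rewrite int_ptE -(ler_int R) rmorphN.
have left i j : L (int_pt (i, j)) -> -1 <= i.
  move=> Lz; have [j0|j0] := leP 0 j.
    have := crossing hL La Lz; rewrite !int_ptE/= ler0z => /(_ j0)/andP[h _].
    by rewrite -(ler_int R) rmorphN/=; lra.
  have jE : j = -1 by have := row _ Lz; rewrite /=; lia.
  rewrite leNgt; apply/negP => i1; apply: Lc; rewrite jE intE rmorphN/= in Lz.
  apply: (convex_row cL Lz La); have : i <= -2 by lia.
  by rewrite -(ler_int R) rmorphN/=; lra.
have right (b : int) i j : L (b%:~R, -1) -> ~ L ((b + 1)%:~R, -1) ->
    L (int_pt (i, j)) -> if 0 <= j then i + j * b <= 1 + j else i <= b.
  move=> Lbb Lb1 Lz; case: ifPn => j0.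
    have := crossing hL Lbb Lz; rewrite !int_ptE/= ler0z => /(_ j0)/andP[_ h].
    by rewrite -(ler_int R) !rmorphD rmorphM/=.
  have jE : j = -1 by have := row _ Lz; rewrite /=; lia.
  rewrite leNgt; apply/negP => i1; apply: Lb1; rewrite jE intE rmorphN/= in Lz.
  apply: (convex_row cL La Lz); have {}i1 : b + 1 <= i by lia.
  have : -1 <= b by have := left b (-1); rewrite intE rmorphN/=; apply.
  move: i1; rewrite -!(ler_int R) rmorphN rmorphD/=; lra.
have [L3|L3] := pselect (L (3, -1)); last first.
  have [L12|L12] := pselect (L (-1, 2)); first by right; exact: hollow_S2.
  left; apply: (@card_seq_le _ _ [:: (-1, -1); (0, -1); (1, -1); (2, -1);
    (-1, 0); (0, 0); (1, 0); (-1, 1); (0, 1)]) => // -[i j] Lz.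
  have /= h1 := row _ Lz; have h2 := left _ _ Lz.
  have := right 2 i j Lb L3 Lz.
  have : ~ (i = -1 /\ j = 2).
    by move=> [ij1 ij2]; apply: L12; move: Lz; rewrite ij1 ij2 /int_pt/= rmorphN.
  by rewrite !inE !xpair_eqE; case: ifPn; lia.
left; have [L4|L4] := pselect (L (4, -1)); last first.
  apply: (@card_seq_le _ _ [:: (-1, -1); (0, -1); (1, -1); (2, -1); (3, -1);
    (-1, 0); (0, 0); (1, 0); (-1, 1)]) => // -[i j] Lz.
  have /= h1 := row _ Lz; have h2 := left _ _ Lz.
  have := right 3 i j L3 L4 Lz.
  by rewrite !inE !xpair_eqE; case: ifPn; lia.
apply: (@card_seq_le _ _ [:: (-1, -1); (0, -1); (1, -1); (2, -1); (3, -1);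
  (4, -1); (-1, 0); (0, 0); (1, 0)]) => // -[i j] Lz.
have /= h1 := row _ Lz; have h2 := left _ _ Lz.
have := right 4 i j L4 Ld Lz.
by rewrite !inE !xpair_eqE; case: ifPn; lia.
Qed.

(** * The triangle with ten lattice points *)

Lemma det2 (U : 'M[int]_2) : \det U = crossZ (U 0 0, U 1 0) (U 0 1, U 1 1).
Proof.
rewrite (expand_det_row _ ord0) big_ord_recl big_ord1 /cofactor !det_mx11 !mxE/=.
rewrite expr0 expr1 /crossZ/=.
have -> : lift ord0 ord0 = 1 :> 'I_2 by apply: val_inj.
have -> : lift 1 0 = 0 :> 'I_2 by apply: val_inj.
by ring.
Qed.

Lemma int_mx_actE (U : 'M[int]_2) x :
  int_mx_act U x = frame (U 0 0, U 1 0) (U 0 1, U 1 1) x.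
Proof. by apply: coordP; rewrite /frame !coordE !int_ptE/=; ring. Qed.

Lemma frame_unimodular e g K : crossZ e g = 1 -> frame e g @^-1` K = S2 ->
  unimodularly_equivalent K S2.
Proof.
move=> eg KS.
pose U : 'M[int]_2 := \matrix_(i, j)
  (if j == 0 then if i == 0 then e.1 else e.2 else if i == 0 then g.1 else g.2).
have UE : [/\ U 0 0 = e.1, U 1 0 = e.2, U 0 1 = g.1 & U 1 1 = g.2].
  by rewrite !mxE.
have [U00 U10 U01 U11] := UE.
have actE x : int_mx_act U x + int_pt (0, 0) = frame e g x.
  rewrite int_mx_actE U00 U10 U01 U11 -!surjective_pairing.
  by apply: coordP; rewrite coordE addr0.
exists U, (0, 0); split.
  by rewrite det2 U00 U10 U01 U11 -!surjective_pairing eg.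
apply/seteqP; split=> [x Kx|x [y]]; last by rewrite -KS actE => ? <-.
exists (coframe e g x); last by rewrite actE coframeK.
by rewrite -KS /= coframeK.
Qed.

Definition S2_points : seq (int * int) :=
  [:: (-1, -1); (0, -1); (1, -1); (2, -1); (-1, 0); (0, 0); (1, 0);
      (-1, 1); (0, 1); (-1, 2)].

Lemma S2_int_pt z : (@S2 R) (int_pt z) <-> z \in S2_points.
Proof.
rewrite S2E /= -rmorphD/=.
have -> : -1 = (-1)%:~R :> R by rewrite rmorphN.
rewrite -[1]/(1%:~R) !ler_int.
case: z => i j; rewrite !inE !xpair_eqE/=; split; first by case; lia.
by move=> h; split; lia.
Qed.

(** Since [U] is invertible over the integers, a point of [S2] with integral
    image is itself integral. *)
Lemma unimodular_card K : unimodularly_equivalent K S2 -> K `&` Z2 #= `I_10.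
Proof.
move=> [U [s [dU KE]]].
set e := (U 0 0, U 1 0); set g := (U 0 1, U 1 1).
have eg2 : crossZ e g * crossZ e g = 1.
  by move/eqP: dU; rewrite det2 -/e -/g eqr_norml => /andP[/orP[]/eqP-> _].
have eg0 : crossZ e g != 0 by apply/eqP => h; move: eg2; rewrite h mulr0.
have sE z : int_mx_act U (int_pt z) + int_pt s =
    int_pt (combZ e g z + s) :> R * R.
  rewrite int_mx_actE frame_int_pt; apply: coordP;
    by rewrite !coordE !int_ptE /= !rmorphD.
apply: card_eq_trans (Z2_card K) _.
have -> : [set z | K (int_pt z)] =
    (fun z => combZ e g z + s) @` [set` S2_points].
  apply/seteqP; split=> [w|w [z /S2_int_pt Sz <-]]; last first.
    by rewrite /= KE; exists (int_pt z).
  rewrite /= KE => -[x Sx xw].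
  have [h1 h2] : x.1 * e.1%:~R + x.2 * g.1%:~R = (w.1 - s.1)%:~R /\
      x.1 * e.2%:~R + x.2 * g.2%:~R = (w.2 - s.2)%:~R.
    have := xw; rewrite int_mx_actE -/e -/g /frame => xw'.
    have := congr1 fst xw'; have := congr1 snd xw'.
    by rewrite !coordE !int_ptE !rmorphB/= => <- <-; split; ring.
  (* The inverse of [U] is its adjugate times its determinant, the latter being
     1 or -1. *)
  pose z := (crossZ e g * ((w.1 - s.1) * g.2 - (w.2 - s.2) * g.1),
             crossZ e g * (e.1 * (w.2 - s.2) - e.2 * (w.1 - s.1))).
  have xz : x = int_pt z.
    have eg2R : (crossZ e g)%:~R * (crossZ e g)%:~R = 1 :> R.
      by rewrite -rmorphM eg2.
    have cR : (crossZ e g)%:~R = e.1%:~R * g.2%:~R - e.2%:~R * g.1%:~R :> R.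
      by rewrite -!rmorphM -rmorphB.
    apply: coordP; rewrite /z int_ptE [RHS]/=.
      transitivity ((crossZ e g)%:~R * ((w.1 - s.1)%:~R * g.2%:~R -
          (w.2 - s.2)%:~R * g.1%:~R) : R);
        last by rewrite -!rmorphM -rmorphB -rmorphM.
      transitivity (x.1 * ((crossZ e g)%:~R * (crossZ e g)%:~R)).
        by rewrite eg2R mulr1.
      by rewrite {2}cR -h1 -h2; ring.
    transitivity ((crossZ e g)%:~R * (e.1%:~R * (w.2 - s.2)%:~R -
        e.2%:~R * (w.1 - s.1)%:~R) : R);
        last by rewrite -!rmorphM -rmorphB -rmorphM.
    transitivity (x.2 * ((crossZ e g)%:~R * (crossZ e g)%:~R)).
      by rewrite eg2R mulr1.
    by rewrite {2}cR -h1 -h2; ring.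
  have zS : z \in S2_points by apply/S2_int_pt; rewrite -xz.
  exists z => //; apply: int_pt_inj.
  by rewrite -sE -xz.
apply: card_eq_trans (@card_seq_eq _ S2_points _); last by [].
apply: inj_card_eq => z z' h h' /addIr[h1 h2].
have crossz p : p.1 * crossZ e g = crossZ (combZ e g p) g.
  by rewrite /crossZ/combZ/=; ring.
have crossz2 p : p.2 * crossZ e g = crossZ e (combZ e g p).
  by rewrite /crossZ/combZ/=; ring.
rewrite [z]surjective_pairing [z']surjective_pairing.
by congr (_, _); apply: (mulIf eg0);
  rewrite ?crossz ?crossz2 /crossZ /combZ/= h1 h2.
Qed.

(** * At most nine lattice points, or the triangle *)

Lemma card_I1 (T : Type) (A : set T) : A #= `I_1 -> exists r : T, A = [set r].
Proof.
move=> /card_set_bijP[f [fA finj fsurj]].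
have [x Ax fx] := fsurj 0%N erefl.
exists x; apply/seteqP; split=> [y Ay|y ->//].
apply: finj; rewrite ?inE//.
by have := fA y Ay; rewrite /= fx; case: (f y).
Qed.

Lemma centroid_hollow K : convex_body K -> centroid K = 0 ->
  K° `&` Z2 #= `I_1 -> hollow K.
Proof.
move=> [cK cvK K0] cK0 h1.
have {}cvK := convexP cvK.
have [p pE] := card_I1 h1.
have [Kp [z zp]] : (K° `&` Z2) p by rewrite pE.
have c0 : core K 0.
  apply: contrapT => nc; have cp := interior_core Kp.
  have [u Ku up] := separation cvK cp nc.
  by have := centroid_support cK K0 cK0 Ku Kp; lra.
have p0 : p = 0.
  suff : (K° `&` Z2) 0 by rewrite pE => ->.
  by split; [exact: core_interior|exists (0, 0)].
split=> // z' cz'; have : (K° `&` Z2) (int_pt z').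
  by split; [exact: core_interior|exists z'].
by rewrite pE /= p0 => h; apply: int_pt_inj; rewrite h.
Qed.

(** Both thirds of the segment are lattice points and they differ, so they
    are not both the origin. *)
Lemma third_not_core K p q : hollow K -> p != q ->
  (p.1 = q.1 %[mod 3])%Z -> (p.2 = q.2 %[mod 3])%Z ->
  exists2 t : R, 0 < t < 1 & ~ core K (t *: int_pt p + (1 - t) *: int_pt q).
Proof.
move=> [_ _ hK] pq pq1 pq2.
have [m qm] := eq_mod3 pq1; have [n qn] := eq_mod3 pq2.
have E1 : (1 / 3) *: int_pt p + (1 - 1 / 3) *: int_pt q =
    int_pt (p.1 + 2 * m, p.2 + 2 * n) :> R * R.
  by apply: coordP; rewrite !coordE !int_ptE ?qm ?qn /= !(rmorphD, rmorphM)/=;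
    field.
have E2 : (2 / 3) *: int_pt p + (1 - 2 / 3) *: int_pt q =
    int_pt (p.1 + m, p.2 + n) :> R * R.
  by apply: coordP; rewrite !coordE !int_ptE ?qm ?qn /= !(rmorphD, rmorphM)/=;
    field.
apply: contrapT => h.
have c1 : core K ((1 / 3) *: int_pt p + (1 - 1 / 3) *: int_pt q).
  by apply: contrapT => c; case: h; exists (1 / 3); [lra|exact: c].
have c2 : core K ((2 / 3) *: int_pt p + (1 - 2 / 3) *: int_pt q).
  by apply: contrapT => c; case: h; exists (2 / 3); [lra|exact: c].
move: c1 c2; rewrite E1 E2 => /hK[a1 b1] /hK[a2 b2].
case/negP: pq; rewrite -pair_eqE /pair_eq/=.
by apply/andP; split; apply/eqP; lia.
Qed.

Lemma few_or_S2 K : convex_body K -> centroid K = 0 -> K° `&` Z2 #= `I_1 ->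
  K `&` Z2 #<= `I_9 \/ unimodularly_equivalent K S2.
Proof.
move=> bK cK0 h1; have hK := centroid_hollow bK cK0 h1.
have [cK K0 Kz] := hK.
have [few|] := pselect (forall p q, K (int_pt p) -> K (int_pt q) ->
    (p.1 = q.1 %[mod 3])%Z -> (p.2 = q.2 %[mod 3])%Z -> p = q).
  by left; exact: few_residues.
move=> /existsNP[p /existsNP[q]].
move=> /not_implyP[Kp /not_implyP[Kq]].
move=> /not_implyP[pq1 /not_implyP[pq2 /eqP pq]].
have [e [g [eg Lb]]] : exists e g,
    crossZ e g = 1 /\ bottom_edge (frame e g @^-1` K) 2.
  have [t t01 nc] := third_not_core hK pq pq1 pq2.
  have [h|h] := supporting_line cK Kp Kq t01 nc.
    exact: (height1_edge hK Kp Kq).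
  by apply: (height1_edge hK Kq Kp) => //; rewrite eq_sym.
have [||g' [eg' [Lb' Ln]]] := @normalized_edge K 3 e g bK cK0 hK eg.
- by [].
- by rewrite (_ : 5 - 3%:R = 2) //; ring.
have hL := hollow_frame eg' hK.
have := edge_count hL Lb' Ln; case.
- move=> L5; apply: (bottom_edge_lt6 bK cK0 hK eg'); case: Lb' => *; split=> //.
- by move=> few; left; exact: card_frame few.
- by move=> LS; right; exact: frame_unimodular LS.
Qed.

End lattice.

Theorem theorem1p2 (R : realType) (K : set (R * R)) :
  convex_body K -> centroid K = 0 -> K° `&` Z2 #= `I_1 ->
  K `&` Z2 #<= `I_10 /\
  (K `&` Z2 #= `I_10 <-> unimodularly_equivalent K S2).
Proof.
move=> bK cK0 h1; split.
  have [few|/unimodular_card] := few_or_S2 bK cK0 h1.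
    by apply: card_le_trans few _; rewrite card_le_II.
  by rewrite card_eq_le => /andP[].
split; last exact: unimodular_card.
have [few|//] := few_or_S2 bK cK0 h1.
rewrite card_eq_le => /andP[_ K10].
by have := card_le_trans K10 few; rewrite card_le_II.
Qed.
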